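(* Let $H$ be an infinite dimensional complex Hilbert space. The C$^*$-algebra $L(H)$ of all bounded linear operators on $H$, regarded as a Jordan Banach triple with respect to $\{a,b,c\}=\frac12(ab^*c+cb^*a)$, is not ternary weakly amenable.
   Context: Let $E$ be a complex Jordan Banach triple (here, a C$^*$-algebra with $\{a,b,c\}=\frac12(ab^*c+cb^*a)$). The dual $E^*$ is a Jordan triple $E$-module with the products $\{a,b,\varphi\}(x)=\{\varphi,b,a\}(x):=\varphi(\{b,a,x\})$ and $\{a,\varphi,b\}(x):=\overline{\varphi(\{a,x,b\})}$ for $a,b,x\in E$, $\varphi\in E^*$. A ternary derivation $\delta:E\to E^*$ is a conjugate linear map with $\delta\{a,b,c\}=\{\delta(a),b,c\}+\{a,\delta(b),c\}+\{a,b,\delta(c)\}$ for all $a,b,c\in E$. For $b\in E$, $\varphi\in E^*$, the map $\delta(b,\varphi):E\to E^*$, $\delta(b,\varphi)(a):=\{b,\varphi,a\}-\{\varphi,b,a\}$, is a ternary derivation; finite sums of such maps are called inner ternary derivations. $E$ is ternary weakly amenable if every continuous ternary derivation $E\to E^*$ is inner. *)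

(* Defs.v *)
From HB Require Import structures.
From mathcomp Require Import all_boot all_order all_algebra.
From mathcomp Require Import complex.
From mathcomp Require Import boolp classical_sets functions reals topology.
From mathcomp Require Import normedtype ring lra interval_inference.

Set Implicit Arguments.
Unset Strict Implicit.
Unset Printing Implicit Defensive.

Import Order.TTheory GRing.Theory Num.Theory.
Import numFieldNormedType.Exports.

Local Open Scope classical_set_scope.
Local Open Scope ring_scope.

Section rnorm.
Variables (R : realType) (V : normedModType R[i]).
Implicit Types x y : V.

(* Norms over R[i] take (real) values in R[i]; rnorm is the R-valued norm. *)
Definition rnorm x : R := complex.Re `|x|.

Lemma rnormE x : `|x| = (rnorm x)%:C%C.
Proof. by rewrite /rnorm RRe_real// ger0_real. Qed.

Lemma rnorm_ge0 x : 0 <= rnorm x.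
Proof. by rewrite -ler0c -rnormE. Qed.

Lemma cvg_norm_le (T : Type) (F : set_system T) (f : T -> V) y M :
  ProperFilter F -> f @ F --> y -> 0 <= M ->
  (\forall t \near F, `|f t| <= M) -> `|y| <= M.
Proof.
move=> FF fy M0 fM.
have [//|My] := real_leP (normr_real y) (ger0_real M0).
have e0 : 0 < `|y| - M by rewrite subr_gt0.
near F => t.
have : `|y - f t| < `|y| - M by near: t; exact: cvgr_dist_lt.
rewrite ltrBrDr => h; suff : `|y| < `|y| by rewrite ltxx.
apply: le_lt_trans h; rewrite -[X in `|X| <= _](subrK (f t)).
by rewrite (le_trans (ler_normD _ _))// lerD2l; near: t.
Unshelve. all: by end_near. Qed.

End rnorm.

Lemma bounded_continuous (R : realType) (V W : normedModType R[i])
    (f : V -> W) (M : R[i]) : linear f -> 0 <= M ->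
  (forall x, `|f x| <= M * `|x|) -> continuous f.
Proof.
move=> lf M0 fM.
pose m := GRing.isLinear.Build R[i] V W *:%R f lf.
pose g : {linear V -> W} := HB.pack f m.
apply: (@bounded_linear_continuous _ _ _ g); apply/linear_boundedP.
near=> r => x /=; rewrite (le_trans (fM x))// ler_wpM2r//.
by near: r; apply: nbhs_pinfty_ge; exact: ger0_real.
Unshelve. all: by end_near. Qed.

(* blop V W is the space of bounded (equivalently, continuous) linear operators
   from V to W; it is normed by the operator norm opnorm below. *)
Definition is_blop (R : realType) (V W : normedModType R[i]) : {pred V -> W} :=
  fun f => `[< linear f /\ continuous f >].
Arguments is_blop {R} V W.

Record blop (R : realType) (V W : normedModType R[i]) := Blop {
  blop_fun :> V -> W ; blop_subproof : blop_fun \in is_blop V W }.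

Section blop_lmod.
Variables (R : realType) (V W : normedModType R[i]).

HB.instance Definition _ := [isSub for @blop_fun R V W].
HB.instance Definition _ := [Choice of blop V W by <:].

Lemma is_blop_submod : submod_closed (is_blop V W).
Proof.
split.
  apply/asboolP; split; first by move=> a x y /=; rewrite scaler0 addr0.
  by move=> x; exact: cvg_cst.
move=> a f g /asboolP[lf cf] /asboolP[lg cg]; apply/asboolP; split.
  move=> b x y.
  rewrite -[LHS]/(a *: f (b *: x + y) + g (b *: x + y)) lf lg.
  rewrite -[X in _ = _ *: X + _]/(a *: f x + g x).
  rewrite -[X in _ = _ + X]/(a *: f y + g y).
  by rewrite !scalerDr !scalerA mulrC addrACA.
move=> x; apply: (@cvgD _ _ _ _ _ (a \*: f) g); last exact: cg.
by apply: cvgZl_tmp; exact: cf.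
Qed.

HB.instance Definition _ :=
  GRing.isSubmodClosed.Build R[i] (V -> W) (is_blop V W) is_blop_submod.
HB.instance Definition _ :=
  [SubChoice_isSubLmodule of blop V W by <:].

Lemma blop_continuous (f : blop V W) : continuous f.
Proof. by have /asboolP[] := blop_subproof f. Qed.

Lemma blop_linear (f : blop V W) : linear f.
Proof. by have /asboolP[] := blop_subproof f. Qed.

HB.instance Definition _ (f : blop V W) :=
  GRing.isLinear.Build R[i] V W *:%R f (blop_linear f).

Definition mkblop (f : V -> W) (lf : linear f) (cf : continuous f) : blop V W :=
  Blop (asboolT (conj lf cf)).

Lemma blopP (f g : blop V W) : f =1 g -> f = g.
Proof. by move=> fg; apply: val_inj; apply/funext. Qed.

Lemma blopDE (f g : blop V W) x : (f + g) x = f x + g x. Proof. by []. Qed.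
Lemma blopZE a (f : blop V W) x : (a *: f) x = a *: f x. Proof. by []. Qed.
Lemma blop0E x : (0 : blop V W) x = 0. Proof. by []. Qed.
Lemma blopNE (f : blop V W) x : (- f) x = - f x. Proof. by []. Qed.

Definition opnorm (f : blop V W) : R :=
  sup [set rnorm (f x) | x in [set x | `|x| <= 1]].

Lemma opnorm_has_sup (f : blop V W) :
  has_sup [set rnorm (f x) | x in [set x | `|x| <= 1]].
Proof.
split; first by exists (rnorm (f 0)), 0 => //=; rewrite normr0 ler01.
have /linear_boundedP/pinfty_ex_gt0[M M0 fM] :
    bounded_near f (nbhs (0 : V)).
  by apply/linear_bounded_continuous; exact: blop_continuous.
exists (complex.Re M) => _ [x /= x1 <-].
have : `|f x| <= M.
  by rewrite (le_trans (fM x))// ler_piMr// ltW.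
by rewrite lecE => /andP[].
Qed.

Lemma opnorm_ge0 (f : blop V W) : 0 <= opnorm f.
Proof.
apply: (@le_trans _ _ (rnorm (f 0))); first exact: rnorm_ge0.
apply: ub_le_sup; first by case: (opnorm_has_sup f).
by exists 0 => //=; rewrite normr0 ler01.
Qed.

Lemma opnormP (f : blop V W) x : `|f x| <= (opnorm f)%:C%C * `|x|.
Proof.
have [->|x0] := eqVneq x 0; first by rewrite linear0 !normr0 mulr0.
have nx0 : 0 < `|x| by rewrite normr_gt0.
rewrite -ler_pdivrMr// mulrC.
have -> : `|x|^-1 * `|f x| = `|f (`|x|^-1 *: x)|.
  by rewrite linearZ/= normrZ normfV normr_id.
rewrite rnormE lecR; apply: ub_le_sup; first by case: (opnorm_has_sup f).
by exists (`|x|^-1 *: x) => //=; rewrite normrZ normfV normr_id mulVf ?gt_eqF.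
Qed.

Lemma opnorm_le (f : blop V W) (M : R) : 0 <= M ->
  (forall x, `|f x| <= M%:C%C * `|x|) -> opnorm f <= M.
Proof.
move=> M0 fM; apply: ge_sup; first by case: (opnorm_has_sup f).
move=> _ [x /= x1 <-]; rewrite -lecR -rnormE (le_trans (fM x))//.
by rewrite ler_piMr// ler0c.
Qed.

Definition blop_norm (f : blop V W) : R[i] := (opnorm f)%:C%C.

Let ler_normD f g : blop_norm (f + g) <= blop_norm f + blop_norm g.
Proof.
rewrite /blop_norm -rmorphD lecR; apply: opnorm_le => [|x].
  by rewrite addr_ge0// opnorm_ge0.
by rewrite rmorphD mulrDl blopDE (le_trans (ler_normD _ _))// lerD// opnormP.
Qed.

Let normrZ_le (a : R[i]) f : blop_norm (a *: f) <= `|a| * blop_norm f.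
Proof.
have ar : `|a| = (complex.Re `|a|)%:C%C by rewrite RRe_real// ger0_real.
rewrite /blop_norm ar -rmorphM lecR; apply: opnorm_le => [|x].
  by rewrite mulr_ge0// ?opnorm_ge0// -ler0c -ar.
by rewrite rmorphM /= -ar normrZ -mulrA ler_wpM2l// opnormP.
Qed.

Let normrZ (a : R[i]) f : blop_norm (a *: f) = `|a| * blop_norm f.
Proof.
apply/le_anti; rewrite normrZ_le/=.
have [->|a0] := eqVneq a 0.
  by rewrite normr0 mul0r /blop_norm ler0c opnorm_ge0.
rewrite -ler_pdivlMl ?normr_gt0// -normfV.
rewrite -[in leLHS](scale1r f) -(mulVf a0) -scalerA.
exact: normrZ_le.
Qed.

Let normr0_eq0 f : blop_norm f = 0 -> f = 0.
Proof.
move=> f0; apply: blopP => x; apply/eqP; rewrite blop0E -normr_le0.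
by rewrite (le_trans (opnormP f x))// [_%:C%C]f0 mul0r.
Qed.

HB.instance Definition _ :=
  Lmodule_isNormed.Build R[i] (blop V W) ler_normD normrZ normr0_eq0.

Lemma blop_normE (f : blop V W) : `|f| = (opnorm f)%:C%C. Proof. by []. Qed.

Lemma blop_norm_le (f : blop V W) x : `|f x| <= `|f| * `|x|. Proof. exact: opnormP. Qed.

Lemma blop_le_norm (f : blop V W) (M : R[i]) : 0 <= M ->
  (forall x, `|f x| <= M * `|x|) -> `|f| <= M.
Proof.
move=> M0 fM; have Mr : M = (complex.Re M)%:C%C by rewrite RRe_real// ger0_real.
rewrite blop_normE Mr lecR; apply: opnorm_le; first by rewrite -ler0c -Mr.
by move=> x; rewrite -Mr.
Qed.

End blop_lmod.

Section blop_complete.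
Variables (R : realType) (V : normedModType R[i]).
Variables (W : completeNormedModType R[i]).

Lemma blop_complete (F : set_system (blop V W)) :
  ProperFilter F -> cauchy F -> cvg F.
Proof.
move=> FF Fc.
have Fe (e : R[i]) : 0 < e ->
    \forall f & g \near F, forall x : V, `|(f : blop V W) x - (g : blop V W) x| <= e * `|x|.
  move=> e0; have Fb : cauchy_ball F by exact/cauchy_ballP.
  move: (Fb _ e0); apply: filterS => -[f g] /= ; rewrite -ball_normE /= => fg x.
  rewrite -blopNE -blopDE (le_trans (blop_norm_le _ _))// ler_wpM2r//.
  exact: ltW.
have Fx (x : V) : cvg ((fun f : blop V W => f x) @ F).
  apply: cauchy_cvg; apply/cauchy_ballP => e e0.
  have e1 : 0 < e / (`|x| + 1) by rewrite divr_gt0// ltr_wpDl.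
  rewrite near_map2; move: (Fe _ e1); apply: filterS => -[f g] /= fg.
  rewrite -ball_normE /=; apply: le_lt_trans (fg x) _.
  rewrite mulrAC ltr_pdivrMr ?ltr_wpDl// ltr_pM2l// ltrDl.
  exact: ltr01.
pose g (x : V) : W := lim ((fun f : blop V W => f x) @ F).
have gx x : f x @[f --> F] --> g x by exact: Fx.
have lg : linear g.
  move=> a x y; apply: cvg_lim => //.
  under eq_cvg do rewrite linearP.
  by apply: cvgD; [apply: cvgZl_tmp|]; exact: gx.
have Fg (e : R[i]) : 0 < e -> \forall f \near F, forall x : V, `|(f : blop V W) x - g x| <= e * `|x|.
  move=> e0; have [/= [A B] [FA FB] AB] := Fe _ e0.
  move: FA; apply: filterS => f Af x.
  apply: (@cvg_norm_le _ _ _ F (fun h : blop V W => f x - h x)).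
  - by apply: cvgB; [exact: cvg_cst|exact: gx].
  - by rewrite mulr_ge0// ltW.
  - by move: FB; apply: filterS => h Bh; exact: (AB (f, h)).
have [f0 f0g] : exists f0 : blop V W, forall x, `|f0 x - g x| <= 1 * `|x|.
  by have /filter_ex := Fg _ ltr01.
have cg : continuous g.
  apply: (@bounded_continuous _ _ _ _ (`|f0| + 1)) => // x.
  rewrite mulrDl -[X in `|X| <= _](subKr (f0 x)).
  by rewrite (le_trans (ler_normB _ _))// lerD// blop_norm_le.
apply/cvg_ex; exists (mkblop lg cg); apply/cvgrPdist_le => e e0.
move: (Fg _ e0); apply: filterS => f fg.
apply: blop_le_norm => [|x]; first exact: ltW.
by rewrite blopDE blopNE /= distrC.
Qed.

HB.instance Definition _ := Uniform_isComplete.Build (blop V W) blop_complete.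

End blop_complete.

(* The inner product is linear in its first argument and conjugate linear in its
   second one. *)
HB.mixin Record isHilbert (R : realType) H of CompleteNormedModule R[i] H := {
  inner : {dot H for (@Num.conj R[i])} ;
  sqr_normE : forall x : H, `|x| ^+ 2 = inner x x }.

#[short(type="hilbertType")]
HB.structure Definition Hilbert (R : realType) :=
  {H of CompleteNormedModule R[i] H & isHilbert R H}.

Local Notation "''[' u , v ]" := (inner u%R v%R) : ring_scope.
Local Notation "''[' u ]" := '[u, u]%R : ring_scope.

Section hilbert_theory.
Variables (R : realType) (H : hilbertType R).
Implicit Types x y z : H.

Lemma innerC x y : '[x, y] = '[y, x]^*.
Proof. by rewrite (hermC inner x y) expr0 mul1r. Qed.

Lemma dnorm_proj x y : y != 0 ->
  '[x - ('[x, y] / '[y]) *: y] = '[x] - `|'[x, y]| ^+ 2 / '[y].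
Proof.
move=> y0; set q := `|'[x, y]| ^+ 2 / '[y].
have ny : '[y] != 0 by rewrite dnorm_eq0.
have rny : '[y]^* = '[y] by rewrite -innerC.
have h : '[x, ('[x, y] / '[y]) *: y] = q.
  by rewrite linearZr_LR/= rmorphM/= fmorphV/= rny mulrAC [_^* * _]mulrC -normCK.
rewrite dnormB h dnormZ.
have -> : `|'[x, y] / '[y]| ^+ 2 * '[y] = q.
  rewrite normrM normfV (ger0_norm (dnorm_ge0 _ _)) exprMn /q -mulrA.
  by congr (_ * _); rewrite expr2 -mulrA mulVf// mulr1.
have -> : q^* = q by apply/CrealP; rewrite ger0_real// /q divr_ge0 ?exprn_ge0.
by rewrite opprD addrA addrK.
Qed.

Lemma cauchy_schwarz x y : `|'[x, y]| <= `|x| * `|y|.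
Proof.
have [->|y0] := eqVneq y 0; first by rewrite linear0r !normr0 mulr0.
rewrite -ler_sqr ?nnegrE ?mulr_ge0// exprMn !sqr_normE -ler_pdivrMr ?dnorm_gt0//.
by rewrite -subr_ge0 -dnorm_proj// dnorm_ge0.
Qed.

Lemma inner_eqr x y : (forall z, '[z, x] = '[z, y]) -> x = y.
Proof.
move=> xy; apply/eqP; rewrite -subr_eq0 -(dnorm_eq0 inner) linearBr/=.
by rewrite xy subrr.
Qed.

Lemma parallelogram x y :
  `|x + y| ^+ 2 + `|x - y| ^+ 2 = 2 * (`|x| ^+ 2 + `|y| ^+ 2).
Proof.
rewrite !sqr_normE dnormB dnormD mulr_natl mulr2n.
by rewrite addrACA subrr addr0.
Qed.

Section riesz.
Variable f : blop H R[i]^o.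

Let S := [set rnorm x ^+ 2 | x in [set x | f x = 1]].

Let riesz_near x y : f x = 1 -> f y = 1 ->
  `|x - y| ^+ 2 <= 2 * (`|x| ^+ 2 + `|y| ^+ 2) - 4 * (inf S)%:C%C.
Proof.
move=> fx fy; rewrite lerBrDr -parallelogram addrC lerD2r.
have -> : x + y = 2 *: (2^-1 *: (x + y)).
  by rewrite scalerA mulfV ?scale1r// pnatr_eq0.
rewrite normrZ exprMn normr_nat -natrX ler_pM2l ?ltr0n//.
rewrite rnormE -rmorphXn/= lecR; apply: ge_inf.
  by exists 0 => _ [w _ <-]; rewrite sqr_ge0.
exists (2^-1 *: (x + y)) => //=.
rewrite linearZ linearD/= fx fy.
by rewrite -[_ *: _]/(2^-1 * (1 + 1)) -[1 + 1]/2 mulVf// pnatr_eq0.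
Qed.

Let riesz_min u : f u = 1 ->
  exists2 z, f z = 1 & forall y, f y = 1 -> `|z| <= `|y|.
Proof.
move=> fu.
have Sinf : has_inf S.
  split; first by exists (rnorm u ^+ 2), u.
  by exists 0 => _ [w _ <-]; rewrite sqr_ge0.
have /choice[x_ x_P] : forall n : nat, exists x,
    f x = 1 /\ rnorm x ^+ 2 < inf S + n.+1%:R^-1.
  move=> n; have n0 : 0 < n.+1%:R^-1 :> R by rewrite invr_gt0.
  have [_ [x fx <-] xn] := inf_adherent n0 Sinf.
  by exists x.
have cx : cauchy (x_ @ \oo).
  apply/cauchy_ballP => e e0; rewrite near_map2.
  have eE : e = (complex.Re e)%:C%C by rewrite RRe_real// gtr0_real.
  have re0 : 0 < complex.Re e by rewrite -ltcR -eE.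
  have e4 : 0 < complex.Re e ^+ 2 / 4 by rewrite divr_gt0 ?exprn_gt0.
  near=> i j; rewrite -ball_normE/=.
  have [fi xi] := x_P i; have [fj xj] := x_P j.
  rewrite -ltr_sqr ?nnegrE//; last exact: ltW.
  apply: le_lt_trans (riesz_near fi fj) _.
  rewrite !rnormE -!rmorphXn/= -rmorphD/=.
  rewrite -[2](rmorph_nat (real_complex R)) -[4](rmorph_nat (real_complex R)).
  rewrite -!rmorphM/= -rmorphB/= eE -rmorphXn/= ltcR.
  have hi : i.+1%:R^-1 < complex.Re e ^+ 2 / 4.
    by near: i; exact: (near_infty_natSinv_lt (PosNum e4)).
  have hj : j.+1%:R^-1 < complex.Re e ^+ 2 / 4.
    by near: j; exact: (near_infty_natSinv_lt (PosNum e4)).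
  move: hi hj xi xj.
  move: (rnorm (x_ i) ^+ 2) (rnorm (x_ j) ^+ 2) (complex.Re e ^+ 2) => a b c.
  move: (i.+1%:R^-1) (j.+1%:R^-1) (inf S) => i1 j1 d; lra.
have xz : cvgn x_ by exact: cauchy_cvg cx.
exists (lim (x_ @ \oo)).
  have : f (x_ n) @[n --> \oo] --> f (lim (x_ @ \oo)).
    exact: cvg_comp xz (@blop_continuous _ _ _ f _).
  move=> /cvg_lim <- //.
  have -> : (fun n => f (x_ n)) = cst 1 by apply/funext => n; case: (x_P n).
  exact: lim_cst.
move=> y fy; set z := lim _ in xz *.
have [//|yz] := real_leP (normr_real z) (normr_real y).
exfalso.
have {}yz : rnorm y < rnorm z by rewrite -ltcR -!rnormE.
pose M := (rnorm y + rnorm z) / 2.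
have yM : rnorm y < M by rewrite /M; lra.
have Mz : M < rnorm z by rewrite /M; lra.
have M0 : 0 <= M by rewrite (le_trans (rnorm_ge0 y))// ltW.
have e0 : 0 < M ^+ 2 - rnorm y ^+ 2.
  by rewrite subr_gt0 ltr_sqr ?nnegrE// rnorm_ge0.
have dy : inf S <= rnorm y ^+ 2 by apply: ge_inf; [case: Sinf|exists y].
suff : `|z| <= M%:C%C by rewrite rnormE lecR leNgt Mz.
apply: (@cvg_norm_le _ _ _ _ x_ _ _ _ xz); first by rewrite ler0c.
near=> n; rewrite rnormE lecR -ler_sqr ?nnegrE ?rnorm_ge0//.
have [_ xn] := x_P n.
have hn : n.+1%:R^-1 < M ^+ 2 - rnorm y ^+ 2.
  by near: n; exact: (near_infty_natSinv_lt (PosNum e0)).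
move: xn hn dy.
move: (rnorm (x_ n) ^+ 2) (M ^+ 2) (rnorm y ^+ 2) (n.+1%:R^-1) (inf S).
by move=> a b c d e; lra.
Unshelve. all: by end_near. Qed.

Lemma riesz : exists y, forall x, f x = '[x, y].
Proof.
have [f0|/existsNP[v fv]] := pselect (forall x, f x = 0).
  by exists 0 => x; rewrite f0 linear0r.
have fu : f ((f v)^-1 *: v) = 1.
  by rewrite linearZ/=; apply: mulVf; exact/eqP.
have [z fz zmin] := riesz_min fu.
have z0 : z != 0.
  apply/eqP => z0; move: fz; rewrite z0 linear0 => /eqP.
  by rewrite eq_sym oner_eq0.
have zk k : f k = 0 -> '[z, k] = 0.
  move=> fk; have [->|k0] := eqVneq k 0; first by rewrite linear0r.
  have : `|z| <= `|z - ('[z, k] / '[k]) *: k|.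
    by apply: zmin; rewrite linearB linearZ/= fk fz scaler0 subr0.
  rewrite -ler_sqr ?nnegrE// !sqr_normE dnorm_proj// lerDl oppr_ge0.
  rewrite pmulr_lle0 ?invr_gt0 ?dnorm_gt0// => h.
  apply/eqP; rewrite -normr_eq0 -sqrf_eq0.
  by apply/eqP/le_anti; rewrite h exprn_ge0.
exists ('[z]^-1 *: z) => x.
have : '[z, x - f x *: z] = 0.
  apply: zk; rewrite linearB linearZ/= fz.
  by rewrite -[_ *: 1]/(_ * 1) mulr1 subrr.
rewrite linearBr/= => /eqP; rewrite subr_eq0 => /eqP h.
rewrite linearZr_LR/= fmorphV/= -innerC (innerC x) h linearZr_LR/= rmorphM/= conjCK.
by rewrite -innerC mulrCA mulVf ?mulr1 ?dnorm_eq0.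
Qed.
End riesz.

Lemma adjoint_ex (b : blop H H) :
  exists c : blop H H, forall x y, '[b x, y] = '[x, c y].
Proof.
have /choice[c cP] : forall y, exists z, forall x, '[b x, y] = '[x, z].
  move=> y.
  have l : linear (fun x => '[b x, y] : R[i]^o).
    by move=> a u v; rewrite linearP linearPl.
  have k : continuous (fun x => '[b x, y] : R[i]^o).
    apply: (@bounded_continuous _ _ _ _ (`|b| * `|y|)) => // x.
    rewrite (le_trans (cauchy_schwarz _ _))// mulrAC ler_wpM2r//.
    exact: blop_norm_le.
  by have [z zP] := riesz (mkblop l k); exists z => x; rewrite -zP.
have lc : linear c.
  move=> a u v; apply: inner_eqr => x.
  by rewrite -cP !linearPr/= !cP.
have cc : continuous c.
  apply: (@bounded_continuous _ _ _ _ `|b|) => // y.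
  have [->|cy0] := eqVneq (c y) 0; first by rewrite normr0 mulr_ge0.
  have cy : 0 < `|c y| by rewrite normr_gt0.
  rewrite -(ler_pM2r cy) -expr2 sqr_normE -cP -[leLHS]ger0_norm; last first.
    by rewrite cP dnorm_ge0.
  rewrite (le_trans (cauchy_schwarz _ _))// mulrAC ler_wpM2r//.
  exact: blop_norm_le.
by exists (mkblop lc cc).
Qed.

(* Characterized by adjointP: '[b x, y] = '[x, adjoint b y]. *)
Definition adjoint (b : blop H H) : blop H H := sval (cid (adjoint_ex b)).

Lemma adjointP (b : blop H H) x y : '[b x, y] = '[x, adjoint b y].
Proof. exact: (svalP (cid (adjoint_ex b))). Qed.

End hilbert_theory.

Section blop_comp.
Variables (R : realType) (U V W : normedModType R[i]).

Lemma blop_comp_linear (f : blop V W) (g : blop U V) : linear (f \o g).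
Proof. by move=> a x y /=; rewrite !linearP. Qed.

Lemma blop_comp_continuous (f : blop V W) (g : blop U V) : continuous (f \o g).
Proof. by move=> x; apply: continuous_comp; exact: blop_continuous. Qed.

Definition blop_comp (f : blop V W) (g : blop U V) : blop U W :=
  mkblop (@blop_comp_linear f g) (@blop_comp_continuous f g).

Lemma blop_comp_norm f g : `|blop_comp f g| <= `|f| * `|g|.
Proof.
apply: blop_le_norm => [|x]; first by rewrite mulr_ge0.
rewrite (le_trans (blop_norm_le f _))// -mulrA ler_wpM2l//.
exact: blop_norm_le.
Qed.

End blop_comp.

Notation "f \oc g" := (blop_comp f g) (at level 40, left associativity).
Notation "f ^#" := (adjoint f) (at level 2, format "f ^#").

Section adjoint_theory.
Variables (R : realType) (H : hilbertType R).
Implicit Types a b c : blop H H.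

Lemma adjoint_uniq b c : (forall x y, '[b x, y] = '[x, c y]) -> c = b^#.
Proof.
by move=> bc; apply: blopP => y; apply: inner_eqr => x; rewrite -bc adjointP.
Qed.

Lemma adjointP' b x y : '[b^# x, y] = '[x, b y].
Proof. by rewrite innerC -adjointP -innerC. Qed.

Lemma adjointK b : b^#^# = b.
Proof. by apply/esym/adjoint_uniq => x y; rewrite adjointP'. Qed.

Lemma adjoint_comp a b : (a \oc b)^# = b^# \oc a^#.
Proof. by apply/esym/adjoint_uniq => x y /=; rewrite -!adjointP. Qed.

Lemma adjoint_conj_linear : linear_for (@Num.conj R[i] \; *:%R) (@adjoint R H).
Proof.
move=> k a b; apply/esym/adjoint_uniq => x y.
rewrite !(blopDE, blopZE) linearPl linearPr/= conjCK.
by rewrite !adjointP.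
Qed.

Lemma adjoint_norm b : `|b^#| <= `|b|.
Proof.
apply: blop_le_norm => // y.
have [->|cy0] := eqVneq (b^# y) 0; first by rewrite normr0 mulr_ge0.
have cy : 0 < `|b^# y| by rewrite normr_gt0.
rewrite -(ler_pM2r cy) -expr2 sqr_normE -adjointP -[leLHS]ger0_norm; last first.
  by rewrite adjointP dnorm_ge0.
rewrite (le_trans (cauchy_schwarz _ _))// mulrAC ler_wpM2r//.
exact: blop_norm_le.
Qed.

End adjoint_theory.

HB.mixin Record isJordanBanachTriple (R : realType) E
    of CompleteNormedModule R[i] E := {
  jtriple : E -> E -> E -> E ;
  jtriple_linear : forall b c, linear (fun a => jtriple a b c) ;
  jtripleC : forall a b c, jtriple a b c = jtriple c b a ;
  jtriple_conj_linear : forall a c,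
    linear_for (@Num.conj R[i] \; *:%R) (fun b => jtriple a b c) ;
  jtriple_jordan : forall a b x y z,
    jtriple a b (jtriple x y z) =
    jtriple (jtriple a b x) y z - jtriple x (jtriple b a y) z
      + jtriple x y (jtriple a b z) ;
  jtriple_continuous :
    continuous (fun p : E * E * E => jtriple p.1.1 p.1.2 p.2) }.

#[short(type="jbTripleType")]
HB.structure Definition JordanBanachTriple (R : realType) :=
  {E of CompleteNormedModule R[i] E & isJordanBanachTriple R E}.

Notation "{[ a , b , c ]}" := (jtriple a b c)
  (at level 0, a, b, c at level 99, format "{[ a ,  b ,  c ]}") : ring_scope.


Notation dual E := (blop E (_[i]^o)).

Notation "''L(' H )" := (blop H H) (format "''L(' H )") : type_scope.

Section dual_module.
Variables (R : realType) (E : jbTripleType R).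
Implicit Types (a b c x : E) (phi : dual E).

Lemma jtriple_linearr a b : linear (jtriple a b).
Proof. by move=> k x y; rewrite !(jtripleC a b) jtriple_linear. Qed.

Lemma jtriple_continuousr a b : continuous (jtriple a b).
Proof.
move=> x; have abx : ((a, b), y) @[y --> x] --> ((a, b), x).
  exact: (cvg_pair (cvg_cst (a, b)) cvg_id).
exact: (cvg_comp _ _ abx (@jtriple_continuous _ E (a, b, x))).
Qed.

Lemma jtriple_continuousm a b : continuous (fun x => jtriple a x b).
Proof.
move=> x; have axb : ((a, y), b) @[y --> x] --> ((a, x), b).
  exact: (cvg_pair (cvg_pair (cvg_cst a) cvg_id) (cvg_cst b)).
exact: (cvg_comp _ _ axb (@jtriple_continuous _ E (a, x, b))).
Qed.

Lemma conj_continuous : continuous (fun z : R[i]^o => z^* : R[i]^o).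
Proof.
move=> z; apply/(@cvgrPdist_le _ _ _ (nbhs z)) => e e0; near=> t.
by rewrite -rmorphB norm_conjC; near: t; exact: cvgr_dist_le.
Unshelve. all: by end_near. Qed.

Lemma dual_actl_linear a b phi : linear (fun x => phi {[b, a, x]}).
Proof. by move=> k x y; rewrite jtriple_linearr linearP. Qed.

Lemma dual_actl_continuous a b phi : continuous (fun x => phi {[b, a, x]}).
Proof.
move=> x; apply: continuous_comp; first exact: jtriple_continuousr.
exact: blop_continuous.
Qed.

(* {a, b, phi} *)
Definition dual_actl a b phi : dual E :=
  mkblop (@dual_actl_linear a b phi) (@dual_actl_continuous a b phi).

(* {phi, b, a} *)
Definition dual_actr phi b a : dual E := dual_actl a b phi.

Lemma dual_actm_linear a phi b :
  linear (fun x => (phi {[a, x, b]})^* : R[i]^o).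
Proof.
move=> k x y; rewrite jtriple_conj_linear linearP rmorphD; congr (_ + _).
exact: etrans (rmorphM _ _ _) (congr1 (fun z => z * _) (conjCK k)).
Qed.

Lemma dual_actm_continuous a phi b :
  continuous (fun x => (phi {[a, x, b]})^* : R[i]^o).
Proof.
move=> x; apply: (@continuous_comp _ _ _ (fun x => phi {[a, x, b]})).
  apply: continuous_comp; first exact: jtriple_continuousm.
  exact: blop_continuous.
exact: conj_continuous.
Qed.

(* {a, phi, b} *)
Definition dual_actm a phi b : dual E :=
  mkblop (@dual_actm_linear a phi b) (@dual_actm_continuous a phi b).

Definition ternary_derivation (d : E -> dual E) : Prop :=
  linear_for (@Num.conj R[i] \; *:%R) d /\
  forall a b c, d {[a, b, c]} =
    dual_actr (d a) b c + dual_actm a (d b) c + dual_actl a b (d c).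

(* delta(b, phi) *)
Definition inner_derivation_at b phi (a : E) : dual E :=
  dual_actm b phi a - dual_actr phi b a.

Definition inner_ternary_derivation (d : E -> dual E) : Prop :=
  exists (n : nat) (b : 'I_n -> E) (phi : 'I_n -> dual E),
    forall a, d a = \sum_(i < n) inner_derivation_at (b i) (phi i) a.

End dual_module.

Definition ternary_weakly_amenable (R : realType) (E : jbTripleType R) : Prop :=
  forall d : E -> dual E,
    continuous d -> ternary_derivation d -> inner_ternary_derivation d.

Section operator_triple.
Variables (R : realType) (H : hilbertType R).
Implicit Types a b c x y z : blop H H.

Definition op_triple a b c : blop H H :=
  2^-1 *: (a \oc b^# \oc c + c \oc b^# \oc a).

Lemma op_tripleC a b c : op_triple a b c = op_triple c b a.
Proof. by rewrite /op_triple [X in _ *: X = _]addrC. Qed.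

Lemma op_tripleE a b c (v : H) :
  op_triple a b c v = 2^-1 *: (a (b^# (c v)) + c (b^# (a v))).
Proof. by []. Qed.

Lemma op_triple_linear b c : linear (fun a => op_triple a b c).
Proof.
move=> k a a'; apply: blopP => v.
rewrite !(blopDE, blopZE, op_tripleE).
rewrite !linearP/= addrACA -scalerDr.
by rewrite linearP.
Qed.

Lemma op_triple_conj_linear a c :
  linear_for (@Num.conj R[i] \; *:%R) (fun b => op_triple a b c).
Proof.
move=> k b b'; apply: blopP => v.
rewrite blopDE [RHS]/= !op_tripleE adjoint_conj_linear.
rewrite !blopDE !blopZE !linearP/= addrACA -scalerDr.
by rewrite linearP.
Qed.

Lemma op_triple_adjoint a b c : (op_triple a b c)^# = op_triple (a^#) (b^#) (c^#).
Proof.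
apply/esym/adjoint_uniq => u v; rewrite !op_tripleE adjointK.
rewrite linearZl_LR linearDl linearZr_LR linearDr/=.
rewrite fmorphV/= rmorph_nat; congr (_ * _).
by rewrite addrC !adjointP !adjointK.
Qed.

Lemma op_triple_jordan a b x y z :
  op_triple a b (op_triple x y z) =
  op_triple (op_triple a b x) y z - op_triple x (op_triple b a y) z
    + op_triple x y (op_triple a b z).
Proof.
apply: blopP => v.
rewrite !(blopDE, blopNE) !op_tripleE op_triple_adjoint !op_tripleE !adjointK.
apply: inner_eqr => w.
rewrite !(linearZ_LR, linearZ, linearD)/=.
by rewrite !linearNr; ring.
Qed.

Lemma blop_comp_cvg (T : Type) (F : set_system T) (FF : Filter F)
    (f g : T -> blop H H) a b :
  f @ F --> a -> g @ F --> b -> f t \oc g t @[t --> F] --> a \oc b.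
Proof.
move=> fa gb; apply/cvgrPdist_le => e e0.
have b0 : 0 < `|b| + 1 by rewrite ltr_wpDl.
have a0 : 0 < `|a| + 1 by rewrite ltr_wpDl.
have e2 : 0 < e / 2 by rewrite divr_gt0.
near=> t.
have -> : a \oc b - f t \oc g t = (a - f t) \oc b + f t \oc (b - g t).
  apply: blopP => v; rewrite !(blopDE, blopNE)/= linearB/=.
  by rewrite addrA subrK.
rewrite [e]splitr (le_trans (ler_normD _ _))// lerD//.
  rewrite (le_trans (blop_comp_norm _ _))//.
  rewrite (@le_trans _ _ ((e / 2) / (`|b| + 1) * (`|b| + 1)))//; last first.
    by rewrite divfK// gt_eqF.
  rewrite ler_pM// ?lerDl//.
  by near: t; apply: cvgr_dist_le => //; rewrite divr_gt0.
rewrite (le_trans (blop_comp_norm _ _))//.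
rewrite (@le_trans _ _ ((`|a| + 1) * ((e / 2) / (`|a| + 1))))//; last first.
  by rewrite mulrC divfK// gt_eqF.
rewrite ler_pM//.
  rewrite -[X in `|X| <= _](subKr a) (le_trans (ler_normB _ _))// lerD2l.
  by near: t; exact: cvgr_dist_le.
by near: t; apply: cvgr_dist_le => //; rewrite divr_gt0.
Unshelve. all: by end_near. Qed.

Lemma adjoint_cvg (T : Type) (F : set_system T) (FF : Filter F)
    (f : T -> blop H H) a :
  f @ F --> a -> (f t)^# @[t --> F] --> a^#.
Proof.
move=> fa; apply/cvgrPdist_le => e e0; near=> t.
have -> : a^# - (f t)^# = (a - f t)^#.
  apply: adjoint_uniq => u v.
  by rewrite !(blopDE, blopNE) linearBl linearBr/= !adjointP.
rewrite (le_trans (adjoint_norm _))//.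
by near: t; exact: cvgr_dist_le.
Unshelve. all: by end_near. Qed.

Lemma op_triple_continuous : continuous
  (fun p : blop H H * blop H H * blop H H => op_triple p.1.1 p.1.2 p.2).
Proof.
move=> [[a b] c].
have ca : p.1.1 @[p --> (a, b, c)] --> a.
  by apply: (@cvg_comp _ _ _ fst fst) cvg_fst cvg_fst.
have cb : p.1.2 @[p --> (a, b, c)] --> b.
  by apply: (@cvg_comp _ _ _ fst snd) cvg_fst cvg_snd.
have cc : p.2 @[p --> (a, b, c)] --> c by exact: cvg_snd.
apply: cvgZl_tmp; apply: cvgD.
  apply: blop_comp_cvg => //; apply: blop_comp_cvg => //; exact: adjoint_cvg.
by apply: blop_comp_cvg => //; apply: blop_comp_cvg => //; exact: adjoint_cvg.
Qed.

HB.instance Definition _ := isJordanBanachTriple.Build R (blop H H)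
  op_triple_linear op_tripleC op_triple_conj_linear op_triple_jordan
  op_triple_continuous.

End operator_triple.

(* No finite family spans V. *)
Definition infinite_dimensional (K : fieldType) (V : lmodType K) : Prop :=
  ~ exists s : seq V, forall v,
      exists c : 'I_(size s) -> K, v = \sum_i c i *: s`_i.

(* Main.v *)
Require Import Defs.
From mathcomp Require Import all_boot all_order all_algebra.
From mathcomp Require Import reals.
From mathcomp Require Import complex finmap.
From mathcomp Require Import boolp classical_sets functions topology normedtype.
From mathcomp Require Import summability ring lra.

(** If the derivation d below were inner, then L(H) would carry an additive
    functional that vanishes on commutators but not at 1, which is impossible
    in infinite dimension.

    Fix a unit vector xi, put psi y = i<y xi, xi>, a functional with
    psi (y^#) = - conj (psi y), and let d a x = psi (a^# x - x a^#).  This is a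
    continuous ternary derivation (commutator_derivationP).  If it is inner,
    say d = sum_i delta(b_i, phi_i), then regrouping the terms of
    delta(b_i, phi_i)(a)(x) according to whether a^# stands to the left or to
    the right of x gives
      d a x = F (a^# x) - G (x a^#)
    with additive functionals F and G, and the symmetry of the module products
    forces F 1 = - G 1 (inner_ternary_derivation_split).  Taking a = 1 yields
    F = G, hence F 1 = 0, and then tau = psi - F is additive, satisfies
    tau (x y) = tau (y x), and has tau 1 = psi 1 = i.

    Such a tau does not exist: an additive tau with tau (x y) = tau (y x)
    kills 1 (trace_id).  No continuity of tau is needed for this, since 1 is a
    finite sum of commutators.  For two orthonormal families b and c with the
    same index type there is a bounded operator u mapping b_i to c_i and killing
    the orthogonal complement of b (transfer_ex).  Then u^# u and u u^# are the
    projections onto the closed spans of b and of c, so tau takes the same value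
    on both: it only sees the index type.  By Zorn's lemma there is a maximal
    set of mutually orthogonal orthonormal sequences, which amounts to an
    orthonormal family indexed by S x nat, and by maximality its orthogonal
    complement is finite dimensional.  On the projection onto the span of an
    S x nat family tau vanishes, because even and odd positions split it into
    two projections of the same type (trace_halving); on projections of finite
    rank it vanishes, because deleting finitely many vectors of an orthonormal
    sequence leaves an orthonormal sequence (trace_finite).  The identity is the
    sum of one projection of each kind. *)

Set Implicit Arguments.
Unset Strict Implicit.
Unset Printing Implicit Defensive.

Import Order.TTheory GRing.Theory Num.Theory.
Import numFieldNormedType.Exports.

Local Open Scope classical_set_scope.
Local Open Scope ring_scope.

Local Notation "''[' u , v ]" := (inner u%R v%R) : ring_scope.
Local Notation "''[' u ]" := '[u, u]%R : ring_scope.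

Local Existing Instance totally_filter.

(** * Operators between orthonormal families *)

Section orthonormal_families.
Variables (R : realType) (H : hilbertType R).

Definition orthonormal_family (I : eqType) (b : I -> H) :=
  forall i j, '[b i, b j] = (i == j)%:R.

Definition orthogonal_to (I : Type) (b : I -> H) (x : H) :=
  forall i, '[x, b i] = 0.

Lemma inner_eq0C (x y : H) : '[x, y] = 0 -> '[y, x] = 0.
Proof. by move=> xy; rewrite innerC xy conjC0. Qed.

Section bessel.
Variables (I : choiceType) (b b' : I -> H).
Hypotheses (ob : orthonormal_family b) (ob' : orthonormal_family b').
Implicit Types (x : H) (A B : {fset I}).

Lemma pythagoras (c : I -> R[i]) (s : seq I) : uniq s ->
  `|\sum_(i <- s) c i *: b' i| ^+ 2 = \sum_(i <- s) `|c i| ^+ 2.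
Proof.
move=> us; rewrite sqr_normE linear_sumlz; apply: eq_big_seq => i si /=.
rewrite linearZl_LR linear_sumr (bigD1_seq i)//= big1 ?addr0.
  by rewrite linearZr_LR/= ob' eqxx mulr1 normCK.
by move=> j /negPf ji; rewrite linearZr_LR/= ob' eq_sym ji mulr0.
Qed.

(** Bessel's inequality: the defect is the squared distance from x to the
    orthogonal projection y of x onto the span of the b_i, i in A. *)
Lemma bessel x A : \sum_(i <- A) `|'[x, b i]| ^+ 2 <= `|x| ^+ 2.
Proof.
set S := \sum_(i <- A) _.
pose y := \sum_(i <- A) '[x, b i] *: b i.
have S0 : 0 <= S by apply: sumr_ge0 => i _; rewrite exprn_ge0.
have xy : '[x, y] = S.
  rewrite /y linear_sumr; apply: eq_bigr => i _.
  by rewrite linearZr_LR/= mulrC normCK.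
have yy : '[y] = S.
  rewrite linear_sumlz; apply: eq_big_seq => i Ai /=.
  rewrite linearZl_LR linear_sumr (bigD1_seq i)//= big1 ?addr0.
    by rewrite linearZr_LR/= ob eqxx mulr1 normCK.
  by move=> j /negPf ji; rewrite linearZr_LR/= ob eq_sym ji mulr0.
have := dnorm_ge0 (@inner R H) (x - y).
rewrite dnormB xy yy -sqr_normE.
have -> : S^* = S by apply/CrealP; exact: ger0_real.
by rewrite opprD addrA addrK subr_ge0.
Qed.

(** The partial sums of the series defining the operator b_i |-> b'_i; the index
    type need not be countable, so they are indexed by finite sets and limits
    are taken along the inclusion order. *)
Definition transfer_sum (x : H) (A : {fset I}) : H :=
  \sum_(i <- A) '[x, b i] *: b' i.

(** By Bessel the real sums S A of the |<x, b_i>|^2 over A are bounded.  Once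
    S A is close to its supremum, enlarging A changes transfer_sum by a vector
    whose squared norm is the increase of S, so the net is Cauchy. *)
Lemma transfer_cvg x : cvg (transfer_sum x @ totally).
Proof.
apply: cauchy_cvg; apply: cauchy_exP => e e0.
have eE : e = (complex.Re e)%:C%C by rewrite RRe_real// gtr0_real.
have re0 : 0 < complex.Re e by rewrite -ltcR -eE.
pose S (A : {fset I}) : R := complex.Re (\sum_(i <- A) `|'[x, b i]| ^+ 2).
have SE A : \sum_(i <- A) `|'[x, b i]| ^+ 2 = (S A)%:C%C.
  by rewrite RRe_real// ger0_real// sumr_ge0// => i _; rewrite exprn_ge0.
have supS : has_sup (range S).
  split; first by exists (S fset0), fset0.
  exists (rnorm x ^+ 2) => _ [A _ <-].
  by rewrite -lecR -SE rmorphXn/= -rnormE bessel.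
have e20 : 0 < complex.Re e ^+ 2 by rewrite exprn_gt0.
have [_ [A _ <-] SA] := sup_adherent e20 supS.
exists (transfer_sum x A); exists A => // B /= AB.
rewrite -ball_normE/= distrC -ltr_sqr ?nnegrE//; last exact: ltW.
pose C := [fset i in B | i \notin A]%fset.
have BA : [fset i in B | i \in A]%fset = A.
  by apply/fsetP => i; rewrite !inE andbC; apply/andb_idr/(fsubsetP AB).
have -> : transfer_sum x B - transfer_sum x A =
    \sum_(i <- C) '[x, b i] *: b' i.
  apply/eqP; rewrite subr_eq; apply/eqP.
  by rewrite /transfer_sum (big_fsetID _ (mem A))/= BA addrC.
have SB : S B <= sup (range S) by apply: ub_le_sup; [case: supS|exists B].
have SAC : S B = S A + S C.
  by rewrite -raddfD/= /S (big_fsetID _ (mem A))/= BA.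
rewrite pythagoras; last exact: fset_uniq.
by rewrite SE eE -rmorphXn/= ltcR; lra.
Qed.

Definition transfer_fun (x : H) : H := lim (transfer_sum x @ totally).

Lemma transfer_funP x : transfer_sum x @ totally --> transfer_fun x.
Proof. exact: transfer_cvg. Qed.

Lemma transfer_linear : linear transfer_fun.
Proof.
move=> a x y; apply: cvg_lim => //.
have -> : transfer_sum (a *: x + y) = a \*: transfer_sum x + transfer_sum y.
  apply/funext => A; rewrite -[RHS]/(a *: transfer_sum x A + transfer_sum y A).
  rewrite /transfer_sum scaler_sumr -big_split/=.
  by apply: eq_bigr => i _; rewrite linearPl scalerDl scalerA.
by apply: cvgD; [apply: cvgZl_tmp|]; exact: transfer_funP.
Qed.

Lemma transfer_norm x : `|transfer_fun x| <= 1 * `|x|.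
Proof.
rewrite mul1r; apply: cvg_norm_le (@transfer_funP x) _ _ => //.
exists fset0 => // A _; rewrite -ler_sqr ?nnegrE// pythagoras ?fset_uniq//.
exact: bessel.
Qed.

Lemma transfer_fun_in i : transfer_fun (b i) = b' i.
Proof.
apply: cvg_lim => //; apply: (@cvg_near_cst _ _ _ _ _ (@totally_filter I)).
exists [fset i]%fset => // A /=; rewrite fsub1set => Ai.
rewrite /transfer_sum (big_fsetD1 i)//= big1_seq ?addr0 ?ob ?eqxx ?scale1r//.
move=> j /=; rewrite !inE ob => /andP[/negPf ji _].
by rewrite eq_sym ji scale0r.
Qed.

Lemma transfer_fun_orthog x : orthogonal_to b x -> transfer_fun x = 0.
Proof.
move=> bx; apply: cvg_lim => //.
have -> : transfer_sum x = cst 0; last exact: cvg_cst.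
by apply/funext => A; rewrite /transfer_sum big1// => i _; rewrite bx scale0r.
Qed.

Lemma transfer_ex : exists u : 'L(H),
  (forall i, u (b i) = b' i) /\ (forall x, orthogonal_to b x -> u x = 0).
Proof.
have tc := bounded_continuous transfer_linear (@ler01 _) transfer_norm.
exists (mkblop transfer_linear tc); split; first exact: transfer_fun_in.
exact: transfer_fun_orthog.
Qed.

End bessel.
End orthonormal_families.

Section transfers.
Variables (R : realType) (H : hilbertType R).

(** These conditions determine u (is_transfer_unique): u is the partial isometry
    mapping b_i to b'_i.  For b' = b it is the projection onto the closed span
    of b. *)
Definition is_transfer (I : Type) (b b' : I -> H) (u : 'L(H)) :=
  (forall i, u (b i) = b' i) /\ (forall x, orthogonal_to b x -> u x = 0).

Definition idop : 'L(H) :=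
  mkblop (fun (a : R[i]) (x y : H) => erefl (a *: x + y))
    (fun x : H => @cvg_id H (nbhs x)).

Lemma idop_adjoint : idop^# = idop.
Proof. by apply/esym/adjoint_uniq. Qed.

Lemma idop_compl (x : 'L(H)) : idop \oc x = x.
Proof. exact: blopP. Qed.

Lemma idop_compr (x : 'L(H)) : x \oc idop = x.
Proof. exact: blopP. Qed.

(** Put T = u - v.  Every vector T^# w is orthogonal to the range of b, because
    T kills b, hence is killed by T, and so
    <T^# w, T^# w> = <w, T (T^# w)> = 0.  Using the adjoint in this way avoids
    decomposing H along the closed span of b. *)
Lemma blop_eq_on (I : Type) (b : I -> H) (u v : 'L(H)) :
  (forall i, u (b i) = v (b i)) ->
  (forall x, orthogonal_to b x -> u x = v x) -> u = v.
Proof.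
move=> uvb uvo; apply/eqP; rewrite -subr_eq0; apply/eqP; set T := u - v.
have Tb i : T (b i) = 0 by rewrite /T blopDE blopNE uvb subrr.
have To x : orthogonal_to b x -> T x = 0.
  by move=> bx; rewrite /T blopDE blopNE uvo// subrr.
apply: blopP => x; rewrite blop0E; apply/eqP.
rewrite -(dnorm_eq0 (@inner R H)) adjointP; set z := T^# (T x).
have zb : orthogonal_to b z by move=> i; rewrite adjointP' Tb linear0r.
suff -> : z = 0 by rewrite linear0r.
apply/eqP; rewrite -(dnorm_eq0 (@inner R H)) {1}/z adjointP' (To z)//.
by rewrite linear0r.
Qed.

Lemma is_transfer_unique (I : Type) (b b' : I -> H) (u v : 'L(H)) :
  is_transfer b b' u -> is_transfer b b' v -> u = v.
Proof.
move=> [ub uo] [vb vo]; apply: (@blop_eq_on _ b) => [i|x bx].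
  by rewrite ub vb.
by rewrite uo ?vo.
Qed.

Lemma is_transfer_comp (I : Type) (b b' b'' : I -> H) (u v : 'L(H)) :
  is_transfer b b' u -> is_transfer b' b'' v -> is_transfer b b'' (v \oc u).
Proof.
move=> [ub uo] [vb vo]; split=> [i|x bx] /=; first by rewrite ub vb.
by rewrite uo ?linear0.
Qed.

Lemma is_transfer_adjoint (I : choiceType) (b b' : I -> H) (u : 'L(H)) :
  orthonormal_family b -> orthonormal_family b' ->
  is_transfer b b' u -> is_transfer b' b u^#.
Proof.
move=> ob ob' [ub uo].
have z0 z : orthogonal_to b z ->
    (forall x, orthogonal_to b x -> '[z, x] = 0) -> z = 0.
  by move=> bz /(_ _ bz) /eqP; rewrite dnorm_eq0 => /eqP.
split=> [i|y b'y].
  apply/eqP; rewrite -subr_eq0; apply/eqP; apply: z0 => [j|x bx].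
    by rewrite linearBl/= adjointP' ub ob' ob subrr.
  by rewrite linearBl/= adjointP' uo// linear0r (inner_eq0C (bx i)) subrr.
apply: z0 => [j|x bx]; rewrite adjointP'; first by rewrite ub.
by rewrite uo ?linear0r.
Qed.

(** Projections add up when an orthonormal family is split into two parts; the
    parts are given by their values, so that they can be reindexed freely. *)
Lemma is_transfer_add (I J K : choiceType)
    (b : I -> H) (c : J -> H) (d : K -> H) (p q r : 'L(H)) :
  orthonormal_family b -> orthonormal_family c -> orthonormal_family d ->
  (forall j k, '[c j, d k] = 0) ->
  (forall i, (exists j, b i = c j) \/ (exists k, b i = d k)) ->
  (forall j, exists i, c j = b i) -> (forall k, exists i, d k = b i) ->
  is_transfer b b p -> is_transfer c c q -> is_transfer d d r ->
  p = q + r.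
Proof.
move=> ob oc od cd bcd cb db [pb po] [qc qo] [rd ro].
apply: (@blop_eq_on _ b) => [i|x bx]; rewrite blopDE.
  rewrite pb; case: (bcd i) => [[j ->]|[k ->]].
    by rewrite qc ro ?addr0// => k; exact: cd.
  by rewrite rd qo ?add0r// => j; exact/inner_eq0C/cd.
rewrite po// qo; last by move=> j; have [i ->] := cb j.
by rewrite ro ?addr0// => k; have [i ->] := db k.
Qed.

End transfers.

(** * Traces of projections *)

Section trace.
Variables (R : realType) (H : hilbertType R) (tau : 'L(H) -> R[i]).
Hypothesis tauD : {morph tau : a b / a + b}.
Hypothesis tauC : forall a b, tau (a \oc b) = tau (b \oc a).

(** With u the partial isometry from b to c, p = u^# u and q = u u^#. *)
Lemma trace_is_transfer (I : choiceType) (b c : I -> H) (p q : 'L(H)) :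
  orthonormal_family b -> orthonormal_family c ->
  is_transfer b b p -> is_transfer c c q -> tau p = tau q.
Proof.
move=> ob oc bp cq; have [u bcu] := transfer_ex ob oc.
have cbu := is_transfer_adjoint ob oc bcu.
rewrite (is_transfer_unique bp (is_transfer_comp bcu cbu)) tauC.
by rewrite (is_transfer_unique cq (is_transfer_comp cbu bcu)).
Qed.

(** Even and odd positions give families indexed by J * nat again, so
    tau p = tau p + tau p. *)
Lemma trace_halving (J : choiceType) (b : J * nat -> H) (p : 'L(H)) :
  orthonormal_family b -> is_transfer b b p -> tau p = 0.
Proof.
move=> ob bp.
pose c m (k : J * nat) := b (k.1, k.2.*2 + m)%N.
have oc m : orthonormal_family (c m).
  move=> [i n] [j k]; rewrite /c ob/= !xpair_eqE eqn_add2r.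
  by rewrite -!muln2 eqn_pmul2r.
have [p0 p0P] := transfer_ex (oc 0%N) (oc 0%N).
have [p1 p1P] := transfer_ex (oc 1%N) (oc 1%N).
have pE : p = p0 + p1.
  apply: (is_transfer_add ob (oc 0%N) (oc 1%N) _ _ _ _ bp p0P p1P).
  - move=> [i n] [j k]; rewrite /c ob xpair_eqE/= addn0 addn1.
    suff -> : (n.*2 == k.*2.+1) = false by rewrite andbF.
    by apply/eqP => /(congr1 odd); rewrite /= !odd_double.
  - move=> [i n]; have := odd_double_half n; case: (odd n) => nE.
      by right; exists (i, n./2); rewrite /c/= addnC nE.
    by left; exists (i, n./2); rewrite /c/= addnC nE.
  - by move=> k; eexists.
  - by move=> k; eexists.
have := congr1 tau pE.
rewrite tauD (trace_is_transfer (oc 0%N) ob p0P bp).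
rewrite (trace_is_transfer (oc 1%N) ob p1P bp) => /eqP.
by rewrite -subr_eq0 opprD addrA subrr add0r oppr_eq0 => /eqP.
Qed.

(** Splitting e into its first n terms and a tail, which is again a sequence,
    shows that tau vanishes on the projection onto the first n terms, hence on
    every projection of rank n. *)
Lemma trace_finite (e : nat -> H) n (f : 'I_n -> H) (p : 'L(H)) :
  orthonormal_family e -> orthonormal_family f ->
  is_transfer f f p -> tau p = 0.
Proof.
move=> oe of_ fp.
pose c (i : 'I_n) := e i; pose d k := e (n + k)%N.
have oc : orthonormal_family c by move=> i j; rewrite /c oe.
have od : orthonormal_family d by move=> i j; rewrite /d oe eqn_add2l.
have [q qP] := transfer_ex oe oe.
have [r rP] := transfer_ex oc oc.
have [s sP] := transfer_ex od od.
have qE : q = r + s.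
  apply: (is_transfer_add oe oc od _ _ _ _ qP rP sP).
  - move=> i k; rewrite /c /d oe.
    by rewrite ltn_eqF// (leq_trans (ltn_ord i))// leq_addr.
  - move=> i; have [ni|ni] := ltnP i n.
      by left; exists (Ordinal ni).
    by right; exists (i - n)%N; rewrite /d subnKC.
  - by move=> k; eexists.
  - by move=> k; eexists.
have := congr1 tau qE.
rewrite tauD (trace_is_transfer od oe sP qP) (trace_is_transfer oc of_ rP fp).
by move=> /eqP; rewrite -subr_eq0 opprD addrCA subrr addr0 oppr_eq0 => /eqP.
Qed.

End trace.

(** * Maximal sets of orthonormal sequences and the trace of the identity *)

Section dichotomy.
Variables (R : realType) (H : hilbertType R).

(** Greedy choice of unit vectors of K orthogonal to the previous ones: either
    it never stops or it stops at a finite family with nothing left in K.  It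
    serves for K = H and for K the orthogonal complement of a family. *)
Lemma orthonormal_dichotomy (K : set H) :
  (forall a x, K x -> K (a *: x)) ->
  (exists2 e : nat -> H, orthonormal_family e & forall n, K (e n)) \/
  (exists n (f : 'I_n -> H), [/\ orthonormal_family f, (forall i, K (f i)) &
     forall x, K x -> orthogonal_to f x -> x = 0]).
Proof.
(* Q n e: the first n terms of e form an orthonormal family in K. *)
move=> KZ; pose Q n (e : nat -> H) := (forall i, (i < n)%N -> K (e i)) /\
  (forall i j, (i < n)%N -> (j < n)%N -> '[e i, e j] = (i == j)%:R).
have [|/existsNP[n /existsNP[e /not_implyP[[Ke oe] noext]]]] := pselect
  (forall n e, Q n e -> exists x,
     [/\ K x, '[x] = 1 & forall i, (i < n)%N -> '[x, e i] = 0]); last first.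
  right; exists n, (fun i : 'I_n => e i); split=> [i j|i|x Kx xe].
  - by rewrite oe.
  - exact: Ke.
  apply: contrapT => /eqP x0; apply: noext; exists (`|x|^-1 *: x); split.
  - exact: KZ.
  - rewrite dnormZ normfV normr_id -sqr_normE exprVn.
    by rewrite mulVf// expf_neq0// normr_eq0.
  - by move=> i ni; rewrite linearZl_LR/= (xe (Ordinal ni)) mulr0.
move=> ext; left.
have /choice[g gP] : forall ne : nat * (nat -> H), exists x, Q ne.1 ne.2 ->
    [/\ K x, '[x] = 1 & forall i, (i < ne.1)%N -> '[x, ne.2 i] = 0].
  move=> [n e]; have [/ext[x xP]|nQ] := pselect (Q n e); first by exists x.
  by exists 0 => /nQ.
(* s n agrees with the sequence e below for its first n terms; defining whole
   sequences lets g depend on all previous choices at once. *)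
pose s := fix s n : nat -> H := if n is m.+1 then
  (fun k => if k == m then g (m, s m) else s m k) else (fun=> 0).
pose e n := g (n, s n).
have se n k : (k < n)%N -> s n k = e k.
  elim: n => // n IH; rewrite ltnS leq_eqVlt /= => /orP[/eqP->|kn].
    by rewrite eqxx.
  by rewrite ltn_eqF// IH.
have Qs n : Q n (s n).
  elim: n => [|n IH]; first by split.
  have [Kx x1 xo] := gP (n, s n) IH; case: IH => KI oI.
  split=> [i|i j]; rewrite !ltnS => ni /=.
    by case: eqP => [_//|/eqP ii]; apply: KI; rewrite ltn_neqAle ii.
  move=> nj; case: eqP => [->|/eqP ii]; case: eqP => [->|/eqP jj].
  - by rewrite eqxx x1.
  - by rewrite xo/= ?(eq_sym n) ?(negPf jj)// ltn_neqAle jj.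
  - rewrite (negPf ii); apply/inner_eq0C/xo.
    by rewrite /= ltn_neqAle ii.
  - by rewrite oI// ltn_neqAle ?ii ?jj.
exists e => [i j|n].
  have [_ h] := Qs (maxn i j).+1.
  rewrite -(se (maxn i j).+1) ?ltnS ?leq_maxl//.
  by rewrite -(se (maxn i j).+1 j) ?ltnS ?leq_maxr// h ?ltnS ?leq_maxl ?leq_maxr.
by have [h _] := Qs n.+1; rewrite -(se n.+1)//; exact: h.
Qed.

Lemma orthonormal_sequence_ex :
  infinite_dimensional H -> exists e : nat -> H, orthonormal_family e.
Proof.
move=> Hinf.
have [//|[e oe _]|[n [f [of_ _ f0]]]] := @orthonormal_dichotomy setT.
  by exists e.
exfalso; apply: Hinf; exists [seq f i | i <- enum 'I_n] => v.
rewrite size_map size_enum_ord; exists (fun i => '[v, f i]).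
apply/eqP; rewrite -subr_eq0; apply/eqP; apply: f0 => // i.
rewrite linearBl/= linear_sumlz (bigD1 i)//= big1 ?addr0.
  rewrite (nth_map i) ?size_enum_ord// nth_ord_enum linearZl_LR/= of_ eqxx.
  by rewrite mulr1 subrr.
move=> j /negPf ji; rewrite (nth_map i) ?size_enum_ord// nth_ord_enum.
by rewrite linearZl_LR/= of_ ji mulr0.
Qed.

(** Orthonormality of the family of all terms of all sequences of S, stated on
    pairs of sequences so that it passes to unions of chains. *)
Definition orthonormal_sequences (S : set (nat -> H)) :=
  forall e e', S e -> S e' -> forall n m,
    '[e n, e' m] = ((e, n) == (e', m))%:R.

Lemma maximal_orthonormal_sequences : exists2 S, orthonormal_sequences S &
  forall e : nat -> H, orthonormal_family e ->
    (forall e' n m, S e' -> '[e n, e' m] = 0) -> False.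
Proof.
have [|S [oS maxS]] := @Zorn_bigcup (nat -> H) orthonormal_sequences.
  move=> F FP Ftot e e' [A FA Ae] [B FB Be'].
  by have [AB|BA] := Ftot A B FA FB; [apply: FP FB _ _ _ _|apply: FP FA _ _ _ _];
    try exact: AB; try exact: BA.
exists S => // e oe eS; apply: (maxS (S `|` [set e])).
  split; first by move=> f; left.
  move=> /(_ e (or_intror erefl)) Se; have := eS e 0 0 Se.
  by rewrite oe eqxx => /eqP; rewrite oner_eq0.
move=> f f' [Sf|->] [Sf'|->] n m.
- exact: oS.
- rewrite (inner_eq0C (eS _ _ _ Sf)) xpair_eqE; case: eqP => // fe.
  by move: (eS f n n Sf); rewrite fe oe eqxx => /eqP; rewrite oner_eq0.
- rewrite (eS _ _ _ Sf') xpair_eqE; case: eqP => // fe.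
  by move: (eS f' n n Sf'); rewrite -fe oe eqxx => /eqP; rewrite oner_eq0.
- by rewrite oe xpair_eqE eqxx.
Qed.

(** Let c be the family of all terms of a maximal set of sequences.  Its
    orthogonal complement contains no orthonormal sequence, so it is spanned by
    a finite family d, and 1 is the sum of the projections onto c and d. *)
Lemma trace_id (tau : 'L(H) -> R[i]) : infinite_dimensional H ->
  {morph tau : a b / a + b} -> (forall a b, tau (a \oc b) = tau (b \oc a)) ->
  tau (idop H) = 0.
Proof.
move=> Hinf tauD tauC; have [e oe] := orthonormal_sequence_ex Hinf.
have [S oS maxS] := maximal_orthonormal_sequences.
pose c (k : S * nat) : H := val k.1 k.2.
have oc : orthonormal_family c.
  move=> [[f Sf] n] [[f' Sf'] m]; rewrite /c/= oS; last 2 first.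
  - exact: set_mem Sf.
  - exact: set_mem Sf'.
  by rewrite !xpair_eqE.
have [|[f of_ cf]|[n [d [od cd dmax]]]] := @orthonormal_dichotomy (orthogonal_to c).
- by move=> a x cx k; rewrite linearZl_LR/= cx mulr0.
- exfalso; apply: (maxS f of_) => e' i m Se'.
  exact: (cf i (exist _ e' (mem_set Se'), m)).
pose b (k : (S * nat) + 'I_n) := match k with inl i => c i | inr j => d j end.
have ob : orthonormal_family b.
  by move=> [i|i] [j|j] /=; rewrite ?oc ?od ?cd//; exact/inner_eq0C/cd.
have idb : is_transfer b b (idop H).
  split=> // x bx; apply: dmax => i; [exact: (bx (inl i))|exact: (bx (inr i))].
have [p pP] := transfer_ex oc oc.
have [q qP] := transfer_ex od od.
have -> : idop H = p + q.
  apply: (is_transfer_add ob oc od _ _ _ _ idb pP qP).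
  - by move=> j k; exact/inner_eq0C/cd.
  - by move=> [i|i]; [left|right]; exists i.
  - by move=> j; exists (inl j).
  - by move=> j; exists (inr j).
rewrite tauD (trace_halving tauD tauC oc pP) (trace_finite tauD tauC oe od qP).
by rewrite addr0.
Qed.

End dichotomy.

(** * The derivation given by commutators with a vector state *)

Section dual_module_apply.
Variables (R : realType) (E : jbTripleType R).
Implicit Types (a b x : E) (phi : dual E).

Lemma dual_actlE a b phi x : dual_actl a b phi x = phi {[b, a, x]}.
Proof. by []. Qed.

Lemma dual_actrE a b phi x : dual_actr phi b a x = phi {[b, a, x]}.
Proof. by []. Qed.

Lemma dual_actmE a b phi x : dual_actm a phi b x = (phi {[a, x, b]})^*.
Proof. by []. Qed.

End dual_module_apply.

Lemma jtriple_opE (R : realType) (H : hilbertType R) (a b c : 'L(H)) :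
  {[a, b, c]} = op_triple a b c.
Proof. by []. Qed.

Section derivation.
Variables (R : realType) (H : hilbertType R) (xi : H).
Implicit Types a b c x y : 'L(H).

(** The factor i makes psi skew, psi y^# = - conj (psi y); without it the
    commutator map below would fail the derivation identity. *)
Definition psi y : R[i] := 'i * '[y xi, xi].

Lemma psi_linear : linear (psi : 'L(H) -> R[i]^o).
Proof.
move=> k x y; rewrite /psi blopDE blopZE linearPl mulrDr; congr (_ + _).
by rewrite mulrCA.
Qed.

Lemma psi_norm y : `|psi y| <= `|y| * `|xi| ^+ 2.
Proof.
rewrite /psi normrM normCi mul1r (le_trans (cauchy_schwarz _ _))// expr2 mulrA.
by rewrite ler_wpM2r// blop_norm_le.
Qed.

Definition commutator_fun c x : R[i]^o := psi (c \oc x - x \oc c).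

Lemma commutator_fun_linear c : linear (commutator_fun c).
Proof.
move=> k x y; rewrite /commutator_fun -psi_linear; congr psi.
apply: blopP => v.
rewrite -[LHS]/(c (k *: x v + y v) - (k *: x (c v) + y (c v))).
rewrite -[RHS]/(k *: (c (x v) - x (c v)) + (c (y v) - y (c v))) linearP.
by rewrite scalerBr opprD addrACA.
Qed.

Lemma commutator_fun_norm c x :
  `|commutator_fun c x| <= `|c| * (2 * `|xi| ^+ 2) * `|x|.
Proof.
have -> : `|c| * (2 * `|xi| ^+ 2) * `|x| =
  (`|c| * `|x| + `|x| * `|c|) * `|xi| ^+ 2 by ring.
rewrite (le_trans (psi_norm _))// ler_wpM2r ?exprn_ge0//.
by rewrite (le_trans (ler_normB _ _))// lerD// blop_comp_norm.
Qed.

Lemma commutator_fun_continuous c : continuous (commutator_fun c).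
Proof.
apply: bounded_continuous (@commutator_fun_linear c) _ (@commutator_fun_norm c).
by rewrite !mulr_ge0// exprn_ge0.
Qed.

Definition commutator_blop c : dual 'L(H) :=
  mkblop (@commutator_fun_linear c) (@commutator_fun_continuous c).

Lemma commutator_blop_linear : linear commutator_blop.
Proof.
move=> k c d; apply: blopP => x; rewrite blopDE blopZE.
rewrite -[LHS]/(commutator_fun _ x).
rewrite -[RHS]/(k *: commutator_fun c x + commutator_fun d x).
rewrite /commutator_fun -psi_linear; congr psi.
apply: blopP => v.
rewrite -[LHS]/(k *: c (x v) + d (x v) - x (k *: c v + d v)).
rewrite -[RHS]/(k *: (c (x v) - x (c v)) + (d (x v) - x (d v))) linearP.
by rewrite scalerBr opprD addrACA.
Qed.

Lemma commutator_blop_continuous : continuous commutator_blop.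
Proof.
apply: (@bounded_continuous _ _ _ _ (2 * `|xi| ^+ 2)) commutator_blop_linear _ _.
  by rewrite mulr_ge0// exprn_ge0.
move=> c; apply: blop_le_norm => [|x]; first by rewrite !mulr_ge0// exprn_ge0.
by rewrite (mulrC _ `|c|); exact: commutator_fun_norm.
Qed.

Definition commutator_derivation a : dual 'L(H) := commutator_blop a^#.

Lemma commutator_derivationE a x :
  commutator_derivation a x = psi (a^# \oc x) - psi (x \oc a^#).
Proof.
rewrite -[LHS]/(psi (a^# \oc x - x \oc a^#)).
by rewrite addrC -scaleN1r psi_linear addrC scaleN1r.
Qed.

Lemma commutator_derivation_continuous : continuous commutator_derivation.
Proof.
move=> a; apply: (@continuous_comp _ _ _ (@adjoint R H)); last first.
  exact: commutator_blop_continuous.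
exact: (@adjoint_cvg _ H _ (nbhs a) _ id a (@cvg_id _ _)).
Qed.

(** Moving every operator to the left slot of the inner product turns both sides
    into combinations of scalars <w xi, xi>, w a word in a^#, b, c^#, x; the
    identity is then linear in these scalars. *)
Lemma commutator_derivationP : ternary_derivation commutator_derivation.
Proof.
split.
  move=> k a b.
  by rewrite /commutator_derivation adjoint_conj_linear commutator_blop_linear.
move=> a b c; apply: blopP => x; rewrite !blopDE.
rewrite dual_actrE dual_actmE dual_actlE !jtriple_opE.
rewrite !commutator_derivationE.
have ocE (f g : 'L(H)) v : (f \oc g) v = f (g v) by [].
have psiBC y z :
    (psi y - psi z)^* = - 'i * '[xi, y xi] + 'i * '[xi, z xi].
  by rewrite /psi rmorphB !rmorphM/= conjCi -!innerC !mulNr opprK.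
rewrite psiBC /psi !ocE.
rewrite op_triple_adjoint !op_tripleE adjointK.
have opD (f : 'L(H)) u v : f (u + v) = f u + f v by exact: linearD.
have opZ (f : 'L(H)) k v : f (k *: v) = k *: f v by exact: linearZ.
rewrite !(opZ, opD).
rewrite !(linearZl_LR, linearZr_LR, linearDl, linearDr) /=.
rewrite !(=^~ adjointP, =^~ adjointP', adjointK).
rewrite fmorphV rmorph_nat.
ring.
Qed.

End derivation.

(** * Inner derivations *)

Section inner.
Variables (R : realType) (H : hilbertType R).

Lemma blop_sumE (V W : normedModType R[i]) n (f : 'I_n -> blop V W) x :
  (\sum_(i < n) f i) x = \sum_(i < n) f i x.
Proof. exact: (big_morph (fun g : blop V W => g x)). Qed.

(** Evaluate delta(b, phi)(a) at x and write {b, x, a} and {b, a, x} out.  The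
    terms with b on the left only involve a^# x (or its adjoint x^# a), and
    those with b on the right only x a^# (or a x^#); they make up F and G.  At 1 both
    reduce to phi(b) and its conjugate, with opposite signs. *)
Lemma inner_ternary_derivation_split (d : 'L(H) -> dual 'L(H)) :
  inner_ternary_derivation d ->
  exists F G : 'L(H) -> R[i], [/\ {morph F : x y / x + y},
    F (idop H) = - G (idop H) &
    forall a x, d a x = F (a^# \oc x) - G (x \oc a^#)].
Proof.
move=> [n [b [phi dE]]].
pose f i (y : 'L(H)) : R[i] :=
  2^-1 * ((phi i (b i \oc y^#))^* - phi i (b i \oc y)).
pose g i (y : 'L(H)) : R[i] :=
  2^-1 * (phi i (y \oc b i) - (phi i (y^# \oc b i))^*).
exists (fun y => \sum_i f i y), (fun y => \sum_i g i y); split.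
- move=> x y; rewrite -big_split; apply: eq_bigr => i _; rewrite /f.
  have -> : (x + y)^# = x^# + y^#.
    by have := adjoint_conj_linear 1 x y; rewrite scale1r /= rmorph1 scale1r.
  have cD (u v : 'L(H)) : b i \oc (u + v) = b i \oc u + b i \oc v.
    by apply: blopP => v'; rewrite blopDE; exact: linearD.
  rewrite !cD !linearD/= rmorphD; set p := (_)^*; set q := (_)^*; ring.
- rewrite -sumrN; apply: eq_bigr => i _; rewrite /f /g.
  by rewrite idop_adjoint idop_compl idop_compr -mulrN opprB.
move=> a x; rewrite dE blop_sumE -sumrB; apply: eq_bigr => i _.
rewrite /inner_derivation_at blopDE blopNE dual_actmE dual_actrE !jtriple_opE.
rewrite /f /g /op_triple !adjoint_comp !adjointK.
have ocA (p q r : 'L(H)) : p \oc (q \oc r) = p \oc q \oc r by exact: blopP.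
have phiZD k (u v : 'L(H)) : phi i (k *: (u + v)) = k * (phi i u + phi i v).
  by rewrite linearZ linearD.
rewrite !phiZD !ocA.
rewrite !rmorphM/= !rmorphD/= fmorphV rmorph_nat.
by set p1 := (_)^*; set p2 := (_)^*; ring.
Qed.

End inner.

Theorem proposition4p4 (R : realType) (H : hilbertType R)
    (Hinf : infinite_dimensional H) :
  ~ ternary_weakly_amenable 'L(H).
Proof.
move=> twa.
have [e oe] := orthonormal_sequence_ex Hinf; pose xi := e 0%N.
have [F [G [FD FG1 dE]]] := inner_ternary_derivation_split
  (twa _ (@commutator_derivation_continuous _ _ xi)
         (@commutator_derivationP _ _ xi)).
have FG x : F x = G x.
  have := dE (idop H) x.
  rewrite commutator_derivationE idop_adjoint idop_compl idop_compr subrr.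
  by move/esym/eqP; rewrite subr_eq0 => /eqP.
have F1 : F (idop H) = 0.
  by have /eqP := FG1; rewrite -FG -subr_eq0 opprK -mulr2n mulrn_eq0 => /eqP.
pose tau x := psi xi x - F x.
have tauD : {morph tau : x y / x + y}.
  move=> x y; rewrite /tau FD opprD -[x in psi xi (x + _)]scale1r psi_linear.
  by rewrite scale1r addrACA.
have tauC x y : tau (x \oc y) = tau (y \oc x).
  have := dE (x^#) y; rewrite commutator_derivationE adjointK -FG => E.
  apply/eqP; rewrite -subr_eq0 /tau opprD opprK addrACA E addrACA subrr.
  by rewrite addNr addr0.
have := trace_id Hinf tauD tauC.
rewrite /tau F1 subr0 /psi oe eqxx mulr1 => /eqP.
by rewrite (negPf (neq0Ci _)).
Qed.
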